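(* Let $n,t\in\mathbb N$ with $t\le n-1$. Let $\mathcal F(n,t)$ be the class of forests on vertex set $[n]$ consisting of exactly $t$ trees such that the vertices $1,\dots,t$ lie in pairwise different trees, let $F$ be chosen uniformly at random from $\mathcal F(n,t)$, and let $(d_F(1),\dots,d_F(n))$ be its degree sequence. Throw $n-t-1$ balls independently and uniformly at random into $n$ bins $B_1,\dots,B_n$ and let $L_j$ be the number of balls in $B_j$. Independently, let $R$ be uniform on $[t]$ and for $j\in[t]$ let $I_j=1$ if $R=j$ and $I_j=0$ otherwise. Then $$(L_1+I_1,\dots,L_t+I_t,\,L_{t+1}+1,\dots,L_n+1)$$ has the same distribution as $(d_F(1),\dots,d_F(n))$.
   Context: $[n]=\{1,\dots,n\}$; $d_F(v)$ is the degree of vertex $v$ in $F$. *)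

(* Defs.v *)
From mathcomp Require Import all_boot all_order all_algebra.

Set Implicit Arguments.
Unset Strict Implicit.
Unset Printing Implicit Defensive.

Import GRing.Theory.

(* A graph on V is given by its set of edges, each edge being a set of
   vertices; it is simple when all edges have exactly two ends. *)
Section Graphs.

Variable V : finType.
Implicit Types (E : {set {set V}}) (x y v : V).

Definition simple_graph E : bool := [forall e in E, #|e| == 2].

(* In a simple graph this relation is irreflexive since [set x; x] is a
   singleton. *)
Definition adj E : rel V := fun x y => [set x; y] \in E.

Definition degree E v : nat := #|[set y | adj E v y]|.

(* A cycle has pairwise distinct vertices, so at most #|V| of them; acyclicP
   below removes this bound. *)
Definition acyclic E : bool :=
  [forall k : 'I_#|V|.+1, forall c : k.-tuple V,
     (2 < k) ==> ~~ ucycleb (adj E) c].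

Definition forest E : bool := simple_graph E && acyclic E.

Definition num_components E : nat := n_comp (adj E) predT.

Lemma acyclicP E :
  reflect (forall c : seq V, ucycle (adj E) c -> size c <= 2) (acyclic E).
Proof.
apply: (iffP forallP) => [H c cP | H k].
  case: leqP => // c2; have /andP[_ uc] := cP.
  have ck : size c < #|V|.+1 by rewrite ltnS -(card_uniqP uc) max_card.
  have /forallP/(_ (in_tuple c)) := H (Ordinal ck).
  by rewrite /= c2 /= => /negP[].
apply/forallP => c; apply/implyP => k2; apply/negP => /H.
by rewrite size_tuple leqNgt k2.
Qed.

End Graphs.

(* Vertex i of [n] = {1, ..., n} is the ordinal of value i - 1, so that the
   vertices 1, ..., t are the ordinals of value less than t. *)
Definition forests_nt (n t : nat) : {set {set {set 'I_n}}} :=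
  [set E | [&& forest E, num_components E == t &
     [forall i : 'I_n, forall j : 'I_n,
        [&& i < t, j < t & i != j] ==> ~~ connect (adj E) i j]]].

Definition degree_sequence (n : nat) (E : {set {set 'I_n}}) :
  {ffun 'I_n -> nat} := [ffun v => degree E v].

(* A discrete distribution on a finite type is represented by its probability
   mass function; independence is the product of mass functions. *)
Section Distributions.

Local Open Scope ring_scope.

Definition uniform (T : finType) (A : {set T}) : T -> rat :=
  fun x => if x \in A then (#|A|%:R)^-1 else 0.

Definition iid (m : nat) (T : finType) (p : T -> rat) :
  {ffun 'I_m -> T} -> rat := fun f => \prod_(i < m) p (f i).

Definition indep_pair (T U : finType) (p : T -> rat) (q : U -> rat) :
  T * U -> rat := fun z => p z.1 * q z.2.

(* The mass function of the random variable X when its argument has mass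
   function p. *)
Definition law (T : finType) (S : eqType) (p : T -> rat) (X : T -> S) :
  S -> rat := fun s => \sum_(x | X x == s) p x.

Definition same_distribution (S : eqType) (p q : S -> rat) : Prop :=
  forall s, p s = q s.

End Distributions.

Definition load (m n : nat) (b : {ffun 'I_m -> 'I_n}) (j : 'I_n) : nat :=
  #|[set i | b i == j]|.

Definition balls_in_bins (n t : nat) :
  {ffun 'I_(n - t - 1) -> 'I_n} * 'I_t -> rat :=
  indep_pair (iid (uniform [set: 'I_n])) (uniform [set: 'I_t]).

Definition shifted_loads (n t : nat)
    (z : {ffun 'I_(n - t - 1) -> 'I_n} * 'I_t) : {ffun 'I_n -> nat} :=
  [ffun j : 'I_n =>
     if j < t then load z.1 j + (z.2 == j :> nat) else load z.1 j + 1].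

(* Main.v *)
(* Call the vertices 1, ..., t roots. A forest of the class is an acyclic graph
   in which every vertex is connected to exactly one root, and it suffices to
   show that every degree sequence s is realised by as many forests as pairs
   (balls, R). Both numbers satisfy the same recursion. If some non-root v has
   s(v) = 1, then in a forest v is a leaf attached to some vertex u, in a pair
   the bin of v is empty and the first ball lies in some bin u; deleting v and
   its edge, or v and the first ball, lowers s by 1 at u and at v and leaves the
   same problem on one vertex less. If there is no such v both numbers are 0: a
   forest with a non-root has a non-root leaf, and there are fewer balls than
   non-roots. To avoid truncated subtraction, the amount by which s has been
   lowered is carried along as an offset e added to the degrees. *)

Require Import Defs.
From mathcomp Require Import all_boot all_order all_algebra.
From mathcomp Require Import zify.

Set Implicit Arguments.
Unset Strict Implicit.
Unset Printing Implicit Defensive.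

(** * Adjacency, leaves and rooted forests *)

Section RootedForests.

Variable V : finType.
Implicit Types (E : {set {set V}}) (A S : {set V}) (x y u v : V).

Lemma adj_sym E : symmetric (adj E).
Proof. by move=> x y; rewrite /adj setUC. Qed.

Lemma adj_subset E E' : E' \subset E -> subrel (adj E') (adj E).
Proof. by move=> sE x y; apply: (subsetP sE). Qed.

Lemma adj_neq E x y : simple_graph E -> adj E x y -> x != y.
Proof. by move=> /forall_inP sE /sE; rewrite cards2; case: (x != y). Qed.

Lemma adj_cover E x y : adj E x y -> (x \in cover E) && (y \in cover E).
Proof.
move=> Exy; apply/andP; split; apply/bigcupP; exists [set x; y] => //;
  by rewrite !inE eqxx ?orbT.
Qed.

Lemma connect_adj_sym E : connect_sym (adj E).
Proof. exact/sym_connect_sym/adj_sym. Qed.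

Lemma connect_isolated E x y :
  x \notin cover E -> connect (adj E) x y -> y = x.
Proof.
move=> xE /connectP[[|z p] //=].
by case/andP=> /adj_cover /andP[]; rewrite (negPf xE).
Qed.

Lemma acyclic_subset E E' : E' \subset E -> acyclic E -> acyclic E'.
Proof.
move=> sE /acyclicP aE; apply/acyclicP => c /andP[cE uc]; apply: aE.
by rewrite /ucycle uc andbT (sub_cycle (adj_subset sE)).
Qed.

Lemma simple_graph_subset E E' :
  E' \subset E -> simple_graph E -> simple_graph E'.
Proof.
move=> /subsetP sE /forall_inP gE.
by apply/forall_inP => e /sE; apply: gE.
Qed.

(* If a path from [x] that cannot be extended ended in a vertex of degree at
   least 2, the second neighbour of that vertex would close a cycle. *)
Lemma exists_leaf E x p :
  simple_graph E -> acyclic E -> p != [::] ->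
  path (adj E) x p -> uniq (x :: p) ->
  exists w, [&& degree E w == 1, w != last x p & connect (adj E) w (last x p)].
Proof.
move=> gE /acyclicP aE.
(* A simple path has at most [#|V|] vertices, so [#|V| - size p] bounds how often it can still be
   extended at the front. *)
move: {2}(#|V| - size p) (leqnn (#|V| - size p)) => k.
elim: k x p => [|k IH] x p szp p0 pE up.
  have : size (x :: p) <= #|V| by rewrite -(card_uniqP up) max_card.
  by move: szp => /=; lia.
case: p p0 szp pE up => // y p _ szp pE up.
have /= /andP[Exy yp] := pE.
have [dx|] := eqVneq (degree E x) 1.
  exists x; rewrite dx /=; apply/andP; split.
    by apply: contraTneq up => /= ->; rewrite mem_last.
  by apply/connectP; exists (y :: p).
move=> dx.
have [z /andP[Exz zy]] : exists z, adj E x z && (z != y).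
  have : 1 < degree E x.
    rewrite ltn_neqAle eq_sym dx card_gt0 /=.
    by apply/set0Pn; exists y; rewrite inE.
  case/card_gt1P=> a [b []]; rewrite !inE => Exa Exb ab.
  have [ay|ay] := eqVneq a y; last by exists a; rewrite Exa.
  by exists b; rewrite Exb -ay eq_sym.
have zx : z != x by rewrite eq_sym (adj_neq gE Exz).
have [zp|zp] := boolP (z \in p).
  case/splitPr: zp pE up {szp yp} => p1 p2 pE up.
  have : size [:: x, y & rcons p1 z] <= 2; last by rewrite /= size_rcons.
  apply: aE; apply/andP; split.
    move: pE; rewrite /= rcons_path last_rcons cat_path /= rcons_path.
    case/and4P=> -> -> -> _.
    by rewrite adj_sym Exz.
  by move: up; rewrite -cat_rcons -!cat_cons cat_uniq; case/andP.
have [|//|||w] := IH z [:: x, y & p].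
- by move: szp => /=; lia.
- by rewrite /= adj_sym Exz Exy.
- by rewrite (cons_uniq z) up !inE !negb_or zx zy zp.
- by move=> /= wP; exists w.
Qed.

(** [A] holds the roots and [S] the vertices still present. The type [V] stays fixed when vertices
    are deleted; [cover E \subset S] leaves the deleted ones isolated. *)
Definition rooted_forest A S E :=
  [&& simple_graph E, acyclic E, cover E \subset S,
      [forall x in S, exists a in A, connect (adj E) a x]
    & [forall a in A, forall b in A, connect (adj E) a b ==> (a == b)]].

Lemma rooted_forestP A S E :
  reflect [/\ simple_graph E, acyclic E, cover E \subset S,
      forall x, x \in S -> exists2 a, a \in A & connect (adj E) a x
    & {in A &, forall a b, connect (adj E) a b -> a = b}]
   (rooted_forest A S E).
Proof.
apply: (iffP and5P) => -[gE aE cE sE rE]; split=> //.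
- by move=> x xS; have /exists_inP := forall_inP sE x xS.
- move=> a b aA bA; have /forall_inP := forall_inP rE a aA.
  by move=> /(_ b bA) /implyP ab /ab /eqP.
- by apply/forall_inP => x /sE ?; apply/exists_inP.
- apply/forall_inP => a aA; apply/forall_inP => b bA.
  by apply/implyP => /rE -> //.
Qed.

(** A path from a non-root to its root, extended at the non-root end, leads to a leaf in the
    component of that root; being another vertex of this component, the leaf is not a root. *)
Lemma rooted_forest_leaf A S E :
    S :\: A != set0 -> rooted_forest A S E ->
  exists2 v, v \in S :\: A & degree E v = 1.
Proof.
case/set0Pn=> x /setDP[xS xA] /rooted_forestP[gE aE cE sE rE].
have [a aA] := sE x xS; rewrite connect_adj_sym => /connectP[p xp def_a].
case/shortenP: xp def_a => q qE uq _ def_a.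
have q0 : q != [::].
  by apply: contraNneq xA => q0; rewrite q0 /= in def_a; rewrite -def_a.
have [w /and3P[/eqP dw wa cw]] := exists_leaf gE aE q0 qE uq.
exists w => //; rewrite -def_a in wa cw; rewrite inE.
have -> /= : w \notin A by apply: contraNN wa => wA; apply/eqP/rE.
apply: (subsetP cE); case: (set_0Vmem [set y | adj E w y]) => [d0|[y]].
  by move: dw; rewrite /degree d0 cards0.
by rewrite inE => /adj_cover /andP[].
Qed.

(** * Attaching a leaf [v] to a vertex [u] *)

Section Leaf.

Variables (E : {set {set V}}) (u v : V).
Hypotheses (vE : v \notin cover E) (uv : u != v).

Let E' := [set v; u] |: E.

Let adj_isolated x : adj E v x = false.
Proof. by apply: contraNF vE => /adj_cover/andP[]. Qed.

Lemma adj_add_leaf x : adj E' v x = (x == u).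
Proof.
rewrite /adj in_setU1 [_ \in E]adj_isolated orbF.
apply/eqP/eqP => [eq_vx|-> //].
have : u \in [set v; x] by rewrite eq_vx !inE eqxx orbT.
by rewrite !inE (negPf uv) => /eqP.
Qed.

Lemma adj_add_leaf_neq x y : x != v -> y != v -> adj E' x y = adj E x y.
Proof.
move=> xv yv; rewrite /adj in_setU1; case: eqP => //= eq_xy.
have : v \in [set x; y] by rewrite eq_xy !inE eqxx.
by rewrite !inE ![v == _]eq_sym (negPf xv) (negPf yv).
Qed.

Lemma degree_add_leaf x : degree E' x = degree E x + ((x == u) + (x == v)).
Proof.
have [->|xv] := eqVneq x v.
  rewrite eq_sym (negPf uv) add0n /degree.
  have -> : [set y | adj E' v y] = [set u].
    by apply/setP => y; rewrite !inE adj_add_leaf.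
  have -> : [set y | adj E v y] = set0.
    by apply/setP => y; rewrite !inE adj_isolated.
  by rewrite cards1 cards0.
rewrite addn0 /degree (cardsD1 v) inE adj_sym adj_add_leaf addnC; congr (_ + _).
apply: eq_card => y; rewrite !inE.
have [->|yv] /= := eqVneq y v; first by rewrite adj_sym adj_isolated.
by rewrite adj_add_leaf_neq.
Qed.

Lemma simple_graph_add_leaf : simple_graph E' = simple_graph E.
Proof.
apply/idP/idP; first by apply/simple_graph_subset/subsetUr.
move=> /forall_inP gE; apply/forall_inP => e /setU1P[->|/gE //].
by rewrite cards2 [v == u]eq_sym uv.
Qed.

(** A cycle through [v], rotated to start there, has [u] both as its second and as its last vertex,
    so it has at most two vertices. *)
Lemma acyclic_add_leaf : acyclic E' = acyclic E.
Proof.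
apply/idP/idP; first by apply/acyclic_subset/subsetUr.
move=> /acyclicP aE; apply/acyclicP => c /andP[cE uc].
have [vc|vc] := boolP (v \in c).
  have [i p eq_c] := rot_to vc.
  rewrite -(size_rot i) eq_c.
  move: cE uc; rewrite -(rot_cycle i) -(rot_uniq i) eq_c.
  case: p {eq_c} => [|y p] //.
  case/lastP: p => [|p z] //.
  rewrite /cycle rcons_path => /andP[/andP[]]; rewrite adj_add_leaf => /eqP->.
  rewrite /= last_rcons adj_sym adj_add_leaf => _ /eqP->.
  by rewrite mem_rcons inE eqxx /= andbF.
apply: aE; rewrite /ucycle uc andbT.
have : all (predC1 v) c by apply/allP => x xc /=; apply: contraNneq vc => <-.
by move=> ac; rewrite -(eq_in_cycle adj_add_leaf_neq ac).
Qed.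

(* Contracting the new edge maps every walk to a walk avoiding the leaf. *)
Lemma connect_add_leaf x y :
  x != v -> y != v -> connect (adj E') x y = connect (adj E) x y.
Proof.
move=> xv yv; apply/idP/idP; last first.
  apply: connect_sub => a b ab.
  by apply/connect1/(adj_subset _ ab)/subsetUr.
pose r z := if z == v then u else z.
have -> : connect (adj E) x y = connect (adj E) (r x) (r y).
  by rewrite /r (negPf xv) (negPf yv).
move=> /connectP[p]; elim: p x {xv yv} => [x _ -> //|z p IH x] /= /andP[xz zp].
move=> /(IH z zp); apply: connect_trans; rewrite /r.
have [xv|xv] := eqVneq x v.
  by move: xz; rewrite xv adj_add_leaf => /eqP->; rewrite (negPf uv).
have [zv|zv] := eqVneq z v.
  by move: xz; rewrite zv adj_sym adj_add_leaf => /eqP->.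
by apply: connect1; rewrite -adj_add_leaf_neq.
Qed.

(** Connections between vertices other than [v] are unchanged, all roots are among these vertices,
    and [v] joins the component of [u]. *)
Lemma rooted_forest_add_leaf A S :
  A \subset S -> v \in S :\: A -> u \in S ->
  rooted_forest A S E' = rooted_forest A (S :\ v) E.
Proof.
move=> sAS /setDP[vS vA] uS.
have Av a : a \in A -> a != v by move=> aA; apply: contraNneq vA => <-.
have vu : connect (adj E') u v.
  by apply: connect1; rewrite adj_sym adj_add_leaf.
apply/rooted_forestP/rooted_forestP;
  rewrite simple_graph_add_leaf acyclic_add_leaf => -[gE aE cE sE rE];
  split=> //.
- rewrite subsetD1 vE andbT; apply: subset_trans cE.
  by rewrite /cover bigcup_setU subsetUr.
- move=> x /setD1P[xv /sE[a aA ax]]; exists a => //.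
  by rewrite -connect_add_leaf ?(Av a).
- by move=> a b aA bA ab; apply: rE; rewrite // connect_add_leaf ?Av.
- rewrite /cover bigcup_setU big_set1 !subUset !sub1set vS uS.
  exact: subset_trans cE (subsetDl _ _).
- have sE' x : x \in S :\ v -> exists2 a, a \in A & connect (adj E') a x.
    move=> xS; have [a aA ax] := sE x xS; exists a => //.
    by rewrite connect_add_leaf ?(Av a) //; case/setD1P: xS.
  move=> x xS; have [->|xv] := eqVneq x v; last by apply: sE'; rewrite !inE xv.
  have [|a aA au] := sE' u; first by rewrite !inE uv.
  by exists a; rewrite // (connect_trans au vu).
- by move=> a b aA bA; rewrite connect_add_leaf ?Av //; apply: rE.
Qed.

End Leaf.

(** An edge at [v] consists of [v] and a neighbour, and [u] is the only neighbour. This supplies the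
    isolation hypothesis of the lemmas on attaching a leaf. *)
Lemma leaf_notin_cover E u v :
  simple_graph E -> degree E v = 1 -> adj E v u ->
  v \notin cover (E :\ [set v; u]).
Proof.
move=> /forall_inP gE /eqP/cards1P[w vw] vu; apply/bigcupP => -[e].
have nv y : adj E v y -> y = u.
  have nw z : adj E v z = (z == w) by have /setP/(_ z) := vw; rewrite !inE.
  by move: vu; rewrite !nw => /eqP-> /eqP.
rewrite !inE => /andP[eu eE] ve; case/negP: eu.
have /cards2P[a [b [_ eab]]] := gE e eE.
have [va|va] : v = a \/ v = b by apply/set2P; rewrite -eab.
  by rewrite eab -(nv b) -?va // /adj va -eab.
by rewrite eab setUC -(nv a) -?va // adj_sym /adj va -eab.
Qed.

(** * Counting forests and codes with prescribed degrees *)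

Definition forests_with_degrees A S (e s : V -> nat) :=
  [set E | rooted_forest A S E && [forall x, degree E x + e x == s x]].

(** [z.1] lists the bins of the balls in order and [z.2] is the value of R; the term [x \in S :\: A]
    is the extra 1 of the non-roots. When [A \subset S], the equation at a deleted vertex says that
    the offset has absorbed all of [s]. *)
Definition codes_with_degrees m A S (e s : V -> nat) :=
  [set z : m.-tuple V * V | [&& all (mem S) z.1, z.2 \in A &
    [forall x, count_mem x z.1 + (x == z.2) + (x \in S :\: A) + e x == s x]]].

Lemma card_forests_rec A S e s v :
    A \subset S -> v \in S :\: A -> s v = (e v).+1 ->
  #|forests_with_degrees A S e s| =
  \sum_(u in S :\ v)
     #|forests_with_degrees A (S :\ v) (fun x => (x == u) + (x == v) + e x) s|.
Proof.
move=> sAS vSA sv; rewrite -sum1_card.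
have dv E : E \in forests_with_degrees A S e s -> degree E v = 1.
  by rewrite inE => /andP[_ /forallP/(_ v) /eqP]; rewrite sv; lia.
(* Each forest is counted once, through the unique neighbour [u] of [v]; exchanging the sums then
   groups the forests by [u]. *)
transitivity (\sum_(E in forests_with_degrees A S e s)
                \sum_(u in S :\ v | adj E v u) 1).
  apply: eq_bigr => E EF; rewrite sum1_card -(dv _ EF).
  apply: eq_card => u; rewrite !inE unfold_in /= !inE; apply/esym/andb_idl => vu.
  move: EF; rewrite inE => /andP[/rooted_forestP[gE _ /subsetP cE _ _] _].
  by rewrite eq_sym (adj_neq gE vu) cE //; case/andP: (adj_cover vu).
rewrite (exchange_big_dep (mem (S :\ v))) /=; last by move=> ? ? _ /andP[].
apply: eq_bigr => u uS; rewrite sum1_card.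
have [uv uS'] := setD1P uS.
have cF E : rooted_forest A (S :\ v) E -> v \notin cover E.
  case/rooted_forestP=> _ _ cE _ _; apply: contraTN isT => /(subsetP cE).
  by rewrite !inE eqxx.
(* Adding the edge between [v] and [u] is injective on forests that leave [v] isolated; its image is
   shown to be the set counted on the left. *)
rewrite -(card_in_imset (f := setU [set [set v; u]])
  (D := mem (forests_with_degrees A (S :\ v) _ _))); last first.
  have nF E : rooted_forest A (S :\ v) E -> [set v; u] \notin E.
    move/cF; apply: contra => vu.
    by apply/bigcupP; exists [set v; u]; rewrite // !inE eqxx.
  move=> E1 E2; rewrite !inE => /andP[/nF E1F _] /andP[/nF E2F _] E12.
  by rewrite -(setU1K E1F) E12 setU1K.
apply: eq_card => E; rewrite unfold_in /=; apply/idP/imsetP.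
  rewrite uS => /andP[EF vu].
  have := EF; rewrite inE => /andP[EF' /forallP dE].
  have [gE _ _ _ _] := rooted_forestP _ _ _ EF'.
  have vc := leaf_notin_cover gE (dv _ EF) vu.
  have EE := setD1K vu; exists (E :\ [set v; u]); rewrite ?EE // inE.
  rewrite -(rooted_forest_add_leaf vc uv sAS) // EE EF' /=.
  apply/forallP => x; rewrite addnA -degree_add_leaf // EE; exact: dE.
case=> E' ; rewrite inE => /andP[E'F /forallP dE] ->; rewrite uS.
have vc := cF _ E'F.
rewrite adj_add_leaf // eqxx inE rooted_forest_add_leaf // E'F /= andbT.
by apply/forallP => x; rewrite degree_add_leaf // -addnA.
Qed.

Lemma card_codes_rec m A S e s v :
    A \subset S -> v \in S :\: A -> s v = (e v).+1 ->
  #|codes_with_degrees m.+1 A S e s| =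
  \sum_(u in S :\ v)
     #|codes_with_degrees m A (S :\ v) (fun x => (x == u) + (x == v) + e x) s|.
Proof.
move=> sAS vSA sv; rewrite -sum1_card.
have [vS vA] := setDP vSA.
(* The first ball lies outside bin [v], where it would bring the total to at least [e v + 2]. *)
rewrite (partition_big (fun z => thead z.1) (mem (S :\ v))) /=; last first.
  case=> b r; case/tupleP: b => u b; rewrite !inE theadE /=.
  case/and3P=> /andP[uS bS] rA /forallP/(_ v) /eqP.
  rewrite sv vSA uS andbT; case: eqP => //= _; lia.
apply: eq_bigr => u uS; rewrite sum1_card.
have [uv uS'] := setD1P uS.
pose f (z : m.-tuple V * V) := (cons_tuple u z.1, z.2).
have f_inj : injective f.
  move=> [b1 r1] [b2 r2] [b12 ->]; congr (_, _); exact: val_inj.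
rewrite -(card_imset _ f_inj); apply: eq_card => z; rewrite unfold_in /=.
(* When [v] leaves [S], its non-root 1 turns into the term [x == v] of the new offset. *)
have SvA x : (x \in S :\: A) = (x \in S :\ v :\: A) + (x == v) :> nat.
  by rewrite !inE; case: eqVneq => [->|_]; rewrite ?vS ?(negPf vA) ?addn0.
apply/idP/imsetP.
  case: z => b r; case/tupleP: b => w b; rewrite inE theadE /=.
  case/andP=> /and3P[/andP[wS bS] rA /forallP dE] /eqP wu; subst w.
  exists (b, r); last by congr (_, _); apply: val_inj.
  rewrite inE /= rA; apply/andP; split.
    apply/allP => x xb; have xS : x \in S := allP bS x xb.
    rewrite !inE xS andbT.
    (* A later ball in bin [v] would also push the total there above [s v]. *)
    apply: contraTneq xb => ->; have /eqP := dE v.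
    rewrite sv vSA -has_pred1 has_count -eqn0Ngt addn1; case: count => [|c] //; lia.
  by apply/forallP => x; have /eqP <- := dE x; rewrite SvA [u == x]eq_sym; lia.
case=> -[b r]; rewrite inE /= => /and3P[bS rA /forallP dE] -> /=.
rewrite inE theadE eqxx andbT /= rA uS'; apply/andP; split.
  by apply: sub_all bS => x /setD1P[].
by apply/forallP => x; have /eqP <- := dE x; rewrite SvA [u == x]eq_sym; lia.
Qed.

(** An edge would connect two distinct roots. *)
Lemma rooted_forest_roots A E : rooted_forest A A E = (E == set0).
Proof.
apply/idP/eqP => [/rooted_forestP[/forall_inP gE _ /subsetP cE _ rE]|->].
  apply/setP => e; rewrite inE; apply/negP => eE.
  have /cards2P[a [b [ab eab]]] := gE e eE.
  have Eab : adj E a b by rewrite /adj -eab.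
  have /andP[/cE aA /cE bA] := adj_cover Eab.
  by case/eqP: ab; apply: rE (connect1 Eab).
have c0 : cover set0 = set0 :> {set V} by rewrite /cover big_set0.
apply/rooted_forestP; split.
- by apply/forall_inP => e; rewrite inE.
- apply/acyclicP => -[|a [|b c]] //=.
  by case/andP=> /=; rewrite /adj inE.
- by rewrite c0 sub0set.
- by move=> x xA; exists x.
- by move=> a b _ _ /connect_isolated-> //; rewrite c0 inE.
Qed.

Lemma degree_set0 x : degree (@set0 {set V}) x = 0.
Proof. by apply: eq_card0 => y; rewrite !inE /adj inE. Qed.

(** The recursion stops at one non-root, where no ball is left: the choice of the root to which [v]
    is attached corresponds to the value of R. *)
Lemma card_forests_codes1 A S e s v :
    A \subset S -> S :\: A = [set v] -> s v = (e v).+1 ->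
  #|forests_with_degrees A S e s| = #|codes_with_degrees 0 A S e s|.
Proof.
move=> sAS SA sv.
have vSA : v \in S :\: A by rewrite SA set11.
have SvA : S :\ v = A by rewrite -SA setDDr setDv set0U; apply/setIidPr.
rewrite (card_forests_rec sAS vSA sv) SvA -[RHS]sum1_card.
rewrite (partition_big snd (mem A)) /=; last by case=> b r; rewrite inE => /and3P[].
apply: eq_bigr => r rA; rewrite sum1_card.
(* [d] says that joining [v] to [r] meets all prescribed degrees; both counts belonging to [r] equal
   its truth value. *)
pose d := [forall x, (x == r) + (x == v) + e x == s x].
transitivity (d : nat).
  have -> : forests_with_degrees A A (fun x => (x == r) + (x == v) + e x) s
      = if d then [set set0] else set0.
    apply/setP => E; rewrite inE rooted_forest_roots.
    case: eqVneq => [->|E0]; last by case: d; rewrite !inE // (negPf E0).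
    have -> : [forall x, degree set0 x + ((x == r) + (x == v) + e x) == s x]
        = d.
      by apply: eq_forallb => x; rewrite degree_set0.
    by case: d; rewrite !inE ?eqxx.
  by case: d; rewrite ?cards1 ?cards0.
have dE (b : 0.-tuple V) :
    [forall x, count_mem x b + (x == r) + (x \in S :\: A) + e x == s x] = d.
  by apply: eq_forallb => x; rewrite tuple0 SA !inE.
have dz b : (b, r) \in codes_with_degrees 0 A S e s = d.
  by rewrite inE /= dE rA tuple0.
have [dT|dF] := boolP d; last first.
  apply/esym/eq_card0 => -[b q]; rewrite unfold_in /=.
  by apply/andP => -[+ /eqP qr]; rewrite qr dz (negPf dF).
rewrite (eq_card (B := pred1 ([tuple], r))) ?card1 // => -[b q].
rewrite unfold_in /= [in RHS]unfold_in /= xpair_eqE.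
have -> /= : b == [tuple] by apply/eqP; rewrite tuple0.
by apply/andb_idl => /eqP->; rewrite dz.
Qed.

(** By pigeonhole [m] balls miss one of the [m.+1] non-root bins, and R, being a root, adds nothing
    there. *)
Lemma code_leaf m A S e s z :
    #|S :\: A| = m.+1 -> z \in codes_with_degrees m A S e s ->
  exists2 v, v \in S :\: A & s v = (e v).+1.
Proof.
move=> cSA; rewrite inE => /and3P[_ rA /forallP dE].
have /subsetPn[v vSA vb] : ~~ (S :\: A \subset z.1).
  apply/negP => /subset_leq_card; rewrite cSA.
  by move/leq_trans/(_ (card_size _)); rewrite size_tuple ltnn.
exists v => //; have /eqP <- := dE v; rewrite vSA (count_memPn vb).
by case: eqP => [vr|_]; [move: vSA; rewrite vr !inE rA | lia].
Qed.

Lemma forest_leaf A S e s E :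
    S :\: A != set0 -> E \in forests_with_degrees A S e s ->
  exists2 v, v \in S :\: A & s v = (e v).+1.
Proof.
move=> SA; rewrite inE => /andP[/(rooted_forest_leaf SA)[v vSA dv] /forallP dE].
by exists v; rewrite // -(eqP (dE v)) dv.
Qed.

Theorem card_forests_codes m A S e s :
    A \subset S -> #|S :\: A| = m.+1 ->
  #|forests_with_degrees A S e s| = #|codes_with_degrees m A S e s|.
Proof.
elim: m S e s => [|m IH] S e s sAS cSA;
  (have [/exists_inP[v vSA /eqP sv]|no_leaf] :=
    boolP [exists v in S :\: A, s v == (e v).+1]; last first).
(* A member of either set would supply a suitable [v], so without one both sets are empty. *)
1,3: have SA : S :\: A != set0 by rewrite -card_gt0 cSA.
1,2: rewrite !eq_card0 // => z; apply: contraNF no_leaf => zF; apply/exists_inP.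
1,3: by have [v vSA /eqP sv] := code_leaf cSA zF; exists v.
1,2: by have [v vSA /eqP sv] := forest_leaf SA zF; exists v.
- apply: (card_forests_codes1 (v := v)) => //.
  by apply/eqP; rewrite eq_sym eqEcard sub1set vSA cards1 cSA.
- rewrite (card_forests_rec sAS vSA sv) (card_codes_rec _ sAS vSA sv).
  apply: eq_bigr => u uS; apply: IH.
    by rewrite subsetD1 sAS; case/setDP: vSA.
  have -> : S :\ v :\: A = (S :\: A) :\ v by rewrite !setDDl setUC.
  by move: cSA; rewrite (cardsD1 v) vSA => -[].
Qed.

End RootedForests.

(** * Equal fibre sizes give equal laws under uniform distributions *)

Section EqualFibers.

Variables (X Y : finType) (S : eqType) (A : {set X}) (B : {set Y}).
Variables (f : X -> S) (g : Y -> S).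
Hypothesis eq_fibers :
  forall s, #|[set x in A | f x == s]| = #|[set y in B | g y == s]|.

(** The values of [f] on [A] and of [g] on [B] form the same multiset. Thus the normalising
    constants agree without a separate count of the forests. *)
Lemma eq_card_fibers : #|A| = #|B|.
Proof.
have fib (Z : finType) (C : {set Z}) (h : Z -> S) s :
    count_mem s (map h (enum C)) = #|[set z in C | h z == s]|.
  rewrite count_map -size_filter cardE /enum_mem -filter_predI; congr size.
  by apply: eq_filter => z; rewrite !inE /= andbC.
rewrite !cardE -(size_map f) -(size_map g); apply/perm_size/allP => s _ /=.
by rewrite !fib eq_fibers.
Qed.

Lemma law_uniform_fibers : law (uniform A) f =1 law (uniform B) g.
Proof.
have lawE (Z : finType) (C : {set Z}) (h : Z -> S) s :
    (law (uniform C) h s = #|[set z in C | h z == s]|%:R * (#|C|%:R)^-1)%R.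
  rewrite /law /uniform -big_mkcondr /= GRing.sumr_const GRing.mulr_natl.
  by congr (_ *+ _)%R; apply: eq_card => z; rewrite !inE unfold_in /= andbC.
by move=> s; rewrite !lawE eq_fibers eq_card_fibers.
Qed.

End EqualFibers.

Lemma balls_in_bins_uniform n t z :
  @balls_in_bins n t z = uniform [set: {ffun 'I_(n - t - 1) -> 'I_n} * 'I_t] z.
Proof.
rewrite /balls_in_bins /indep_pair /iid /uniform !inE.
under eq_bigr do rewrite inE.
rewrite GRing.prodr_const !cardsT card_prod card_ffun !card_ord.
by rewrite GRing.natrM GRing.natrX GRing.invfM GRing.exprVn.
Qed.

(** * Translating the given class of forests and the shifted loads into rooted forests and codes *)

Section ForestsNT.

Variables (n t : nat) (t_le : t <= n).

Definition initial_vertices : {set 'I_n} := [set i : 'I_n | i < t].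

Let A := initial_vertices.

Lemma initial_verticesE : A = widen_ord t_le @: [set: 'I_t].
Proof.
apply/setP => i; rewrite inE; apply/idP/imsetP => [it|[j _ ->] /=].
  by exists (Ordinal it); rewrite ?inE //; apply: val_inj.
exact: ltn_ord.
Qed.

Lemma widen_ord_inj : injective (widen_ord t_le).
Proof. by move=> i j /(congr1 val) /= ij; apply: val_inj. Qed.

Lemma card_initial_vertices : #|A| = t.
Proof.
rewrite initial_verticesE card_imset ?cardsT ?card_ord //.
exact: widen_ord_inj.
Qed.

(* The roots meet [t] different components, so there are exactly [t]
   components if and only if the roots meet all of them. *)
Lemma forests_ntE E : (E \in forests_nt n t) = rooted_forest A setT E.
Proof.
have symE := connect_adj_sym E.
(* [fingraph.root (adj E) a] is the canonical representative of the component of [a]; roots in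
   different components have different representatives. *)
have rootsE (rE : {in A &, forall a b, connect (adj E) a b -> a = b}) :
    #|[set fingraph.root (adj E) a | a in A]| = t.
  rewrite card_in_imset ?card_initial_vertices // => a b aA bA /eqP.
  by rewrite root_connect //; apply: rE.
have sub_roots : [set fingraph.root (adj E) a | a in A] \subset roots (adj E).
  by apply/subsetP => _ /imsetP[a _ ->]; apply: roots_root.
have nE : num_components E = #|roots (adj E)|.
  by apply: eq_card => x; rewrite !inE andbT.
rewrite inE; apply/idP/idP.
  case/and3P=> /andP[gE aE] /eqP nt /'forall_forallP dE.
  have rE : {in A &, forall a b, connect (adj E) a b -> a = b}.
    move=> a b; rewrite !inE => aA bA cab; apply/eqP; apply: contraTT cab => ab.
    by have /implyP-> := dE a b; rewrite ?aA ?bA.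
  apply/rooted_forestP; split=> // x _.
  have eq_card_roots :
      #|[set fingraph.root (adj E) a | a in A]| = #|roots (adj E)|.
    by rewrite rootsE // -nE nt.
  have := roots_root symE x.
  rewrite -[roots _ _](subset_cardP eq_card_roots sub_roots).
  by case/imsetP=> a aA /esym/eqP; rewrite root_connect // => ax; exists a.
case/rooted_forestP=> gE aE _ sE rE; apply/and3P; split; first exact/andP.
  rewrite nE -(rootsE rE); apply/eqP/esym/eq_card => x.
  apply/idP/idP => [/(subsetP sub_roots) //|/eqP xr].
  have [a aA ax] := sE x (in_setT x); apply/imsetP; exists a => //.
  by rewrite -xr; apply/esym/eqP; rewrite root_connect.
apply/forallP => i; apply/forallP => j; apply/implyP => /and3P[it jt].
by apply: contra => ij; apply/eqP/rE; rewrite // inE.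
Qed.

Lemma card_degree_fiber s :
  #|[set E in forests_nt n t | degree_sequence E == s]| =
  #|forests_with_degrees A setT (fun=> 0) s|.
Proof.
apply: eq_card => E; rewrite inE forests_ntE inE; congr (_ && _).
apply/eqP/forallP => [<- x|dE]; first by rewrite ffunE addn0.
by apply/ffunP => x; rewrite ffunE -(eqP (dE x)) addn0.
Qed.

Lemma load_count m (b : {ffun 'I_m -> 'I_n}) j :
  count_mem j [tuple b i | i < m] = load b j.
Proof.
rewrite /load cardE /enum_mem size_filter /= count_map -enumT.
by apply: eq_count => i; rewrite /= inE.
Qed.

Lemma card_loads_fiber s :
  #|[set z in [set: {ffun 'I_(n - t - 1) -> 'I_n} * 'I_t]
      | shifted_loads z == s]| =
  #|codes_with_degrees (n - t - 1) A setT (fun=> 0) s|.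
Proof.
pose f (z : {ffun 'I_(n - t - 1) -> 'I_n} * 'I_t) :=
  ([tuple z.1 i | i < n - t - 1], widen_ord t_le z.2).
have f_inj : injective f.
  move=> [b r] [b' r'] eq_f; have eqb := congr1 fst eq_f.
  have /= /widen_ord_inj-> := congr1 snd eq_f; congr (_, _).
  by apply/ffunP => i; have := congr1 (fun b => tnth b i) eqb; rewrite !tnth_mktuple.
rewrite -(card_imset _ f_inj); apply: eq_card => z.
(* At a non-root [x] one has [y.2 < t <= x], so R contributes nothing and the non-root term gives
   the 1; at a root it is the other way round. *)
have dE y : [forall x, count_mem x (f y).1 + (x == (f y).2)
                + (x \in setT :\: A) + 0 == s x] = (shifted_loads y == s).
  apply/forallP/eqP => [dE|<- x].
    apply/ffunP => x; rewrite ffunE -(eqP (dE x)) load_count !inE.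
    rewrite -val_eqE /= andbT eq_sym; case: ltnP => xt /=; first by lia.
    by have := ltn_ord y.2; lia.
  rewrite ffunE load_count !inE -val_eqE /= andbT eq_sym.
  by case: ltnP => xt /=; [lia | have := ltn_ord y.2; lia].
apply/imsetP/idP => [[y + ->]|].
  rewrite !inE /= => ys; rewrite -(dE y) in ys; rewrite ys andbT ltn_ord andbT.
  by apply/allP => x _; apply: in_setT.
case: z => b r; rewrite inE => /and3P[_ /= rA sE].
rewrite inE in rA.
have fz : f ([ffun i => tnth b i], Ordinal rA) = (b, r).
  congr (_, _); last exact: val_inj.
  by apply: eq_from_tnth => i; rewrite tnth_mktuple ffunE.
by exists ([ffun i => tnth b i], Ordinal rA); rewrite ?fz // !inE -dE fz.
Qed.

End ForestsNT.

Theorem theorem6p2 (n t : nat) (t_gt0 : 0 < t) (t_le : t <= n - 1) :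
  same_distribution
    (law (@balls_in_bins n t) (@shifted_loads n t))
    (law (uniform (forests_nt n t)) (@degree_sequence n)).
Proof.
have tn : t <= n by lia.
move=> s; rewrite -(law_uniform_fibers
  (A := [set: {ffun 'I_(n - t - 1) -> 'I_n} * 'I_t]) (f := @shifted_loads n t)).
  by apply: eq_bigr => z _; apply: balls_in_bins_uniform.
move=> {}s; rewrite card_degree_fiber // card_loads_fiber //.
apply/esym/card_forests_codes; first exact: subsetT.
(* Positivity of [t] excludes [n = 0], where the truncated [n - 1] would allow [t = n]; hence there
   is exactly one more non-root than balls. *)
have := cardsC (initial_vertices n t).
rewrite setTD card_initial_vertices // card_ord; lia.
Qed.
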